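(* Let $f_n \colon [-1,1] \to [-1,1]$, $n = 1,2,\ldots$, be maps with $f_n(0) = 0$ and with $f_n{\restriction}_{[-1,0]}$ and $f_n{\restriction}_{[0,1]}$ both non-constant for each $n$. Suppose that for each $n$, all radial departures of $f_n$ have the same orientation (that is, $f_n$ does not have both a positive and a negative radial departure; the orientation may depend on $n$). Then there exists an embedding of $X = \varprojlim \langle [-1,1], f_n \rangle$ into $\mathbb{R}^2$ for which the point $\langle 0,0,\ldots \rangle \in X$ is accessible.
   Context: ''Map'' means continuous function. Inverse limit: $\varprojlim \langle [-1,1], f_n \rangle = \{ \langle x_n \rangle_{n=1}^\infty : f_n(x_{n+1}) = x_n \text{ for each } n \}$, a subspace of the product $\prod_{n=1}^\infty [-1,1]$. If $\Omega \colon X \to \mathbb{R}^2$ is an embedding and $x \in X$, then $x$ is accessible (for $\Omega$) if there is an arc $A \subset \mathbb{R}^2$ with $A \cap \Omega(X) = \{\Omega(x)\}$. For a map $f \colon [-1,1] \to [-1,1]$ with $f(0)=0$, a radial departure of $f$ is a pair $\langle x_1,x_2 \rangle$ with $-1 \leq x_1 < 0 < x_2 \leq 1$ such that either (1) $f((x_1,x_2)) = (f(x_1),f(x_2))$, in which case it is called positively oriented (a positive radial departure), or (2) $f((x_1,x_2)) = (f(x_2),f(x_1))$, in which case it is called negatively oriented (a negative radial departure). Here $(a,b)$ denotes an open interval. *)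

(* Defs.v *)
From mathcomp Require Import all_boot all_order all_algebra.
From mathcomp Require Import all_classical all_reals all_analysis.

Set Implicit Arguments.
Unset Strict Implicit.
Unset Printing Implicit Defensive.

Import Order.TTheory GRing.Theory Num.Theory.
Import numFieldNormedType.Exports.

Local Open Scope classical_set_scope.
Local Open Scope ring_scope.

(* [g], of which only the values on [A] matter, restricts to a homeomorphism
   from the subspace [A] of [S] onto the subspace [g @` A] of [T]; the last
   clause says that this restriction is open onto its image. *)
Definition embedding_on (S T : topologicalType) (A : set S) (g : S -> T) :=
  [/\ {within A, continuous g},
      set_inj A g &
      forall U : set S, open U ->
        exists2 V : set T, open V & g @` (A `&` U) = g @` A `&` V].

Definition is_arc (R : realType) (T : topologicalType) (L : set T) :=
  exists2 gamma : R -> T,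
    embedding_on `[0 : R, 1]%classic gamma & L = gamma @` `[0 : R, 1]%classic.

(* Intended for an embedding [Omega] of [X] and a point [x] of [X]. *)
Definition accessible (R : realType) (S : topologicalType) (X : set S)
    (Omega : S -> R * R) (x : S) :=
  exists2 L : set (R * R), is_arc R L & L `&` Omega @` X = [set Omega x].

(* Self-maps of [-1, 1] are represented by functions on R of which only the
   restriction to [-1, 1] matters. *)
Definition interval_map (R : realType) (f : R -> R) :=
  {within `[-1, 1]%classic, continuous f} /\
  set_fun `[-1, 1]%classic `[-1, 1]%classic f.

(* Sequences are indexed from 0 instead of 1; [{ptws nat -> R}] carries the
   product topology. *)
Definition inverse_limit (R : realType) (f : nat -> R -> R) :
    set {ptws nat -> R} :=
  [set x | (forall n, `[-1, 1]%classic (x n)) /\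
           (forall n, f n (x n.+1) = x n)].

Definition nonconstant_on (T U : Type) (A : set T) (f : T -> U) :=
  exists x y, [/\ A x, A y & f x <> f y].

(* An open interval [`]a, b[] with [b <= a] is empty, so the equations below
   force [f x1 < f x2], respectively [f x2 < f x1]. *)
Definition positive_radial_departure (R : realType) (f : R -> R) (x1 x2 : R) :=
  [/\ -1 <= x1 < 0, 0 < x2 <= 1 &
      f @` `]x1, x2[%classic = `]f x1, f x2[%classic].

Definition negative_radial_departure (R : realType) (f : R -> R) (x1 x2 : R) :=
  [/\ -1 <= x1 < 0, 0 < x2 <= 1 &
      f @` `]x1, x2[%classic = `]f x2, f x1[%classic].

(* Main.v *)
(* Let [f] have no negative radial departure.  Then two walkers can move along
   the left and the right half of the domain, from [0] to the ends and
   without turning back, so that [f] at the left walker stays (almost) below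
   [f] at the right one: each waits at a record while the other proceeds, and
   a deadlock would be a negative radial departure.  Taking time as the height
   embeds the interval in a thin strip, with first coordinate close to [f],
   such that the vertical ray below the image of [0] meets the image in that
   point only.  A thickening of this picture is an injective map [G] of a box
   into itself, uniformly close to [(x, y) |-> (f x, 0)], with
   [G^-1 (ray) <= ray].  If there is no positive radial departure, reflect the
   domain.

   Choosing the folds [G_n] for the bonding maps [f_n] one after the other,
   each close enough to [f_n] with respect to all the previous ones, the limits
   [p_n] of [G_n ... G_(n+k-1) (x_(n+k), 0)] exist and satisfy
   [p_n = G_n p_(n+1)], and [x |-> p_0] is an embedding of the inverse limit.
   If [p_0] is on the ray then so are all the [p_n], which forces [x = 0]. *)
Require Import Defs.
From mathcomp Require Import all_boot all_order all_algebra.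
From mathcomp Require Import all_classical all_reals all_analysis.
From mathcomp Require Import ring lra zify.

Set Implicit Arguments.
Unset Strict Implicit.
Unset Printing Implicit Defensive.

Import Order.TTheory GRing.Theory Num.Theory.
Import numFieldNormedType.Exports.

Local Open Scope classical_set_scope.
Local Open Scope ring_scope.

(** * Lattice paths of two walkers on finite sequences *)

Definition lattice_path (u v : nat -> nat) (M i j : nat) :=
  [/\ u 0%N = 0%N /\ v 0%N = 0%N, u M = i /\ v M = j &
      forall k, (u k <= u k.+1 <= (u k).+1)%N /\ (v k <= v k.+1 <= (v k).+1)%N].

Section LatticePath.
Context {R : realType} (g h : nat -> R).

(** The inequality is asked at all times, also after [M]: paths are total functions, and prolonging
    one freezes both walkers at the new endpoint. *)
Definition reachable (i j : nat) :=
  exists u v M, lattice_path u v M i j /\ forall k, g (u k) < h (v k).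

Lemma reachable_step i j i' j' : reachable i j ->
  (i <= i' <= i.+1)%N -> (j <= j' <= j.+1)%N -> g i' < h j' -> reachable i' j'.
Proof.
move=> [u [v [M [[[u0 v0] [uM vM] st] lt_gh]]]] Hi Hj gh.
pose ext (w : nat -> nat) (x k : nat) := if (k <= M)%N then w k else x.
exists (ext u i'), (ext v j'), M.+1; split; last first.
  by move=> k; rewrite /ext; case: ifP.
split; rewrite /ext //= ?ltnn //.
move=> k; case: (ltngtP k M) => [ltkM|ltMk|->].
- exact: st.
- by rewrite leqnn leqnSn /= !leqnn leqnSn.
- by rewrite uM vM.
Qed.

Lemma reachable_left i j i' : reachable i j -> (i <= i')%N ->
  (forall k, (i < k <= i')%N -> g k < h j) -> reachable i' j.
Proof.
move=> rij; elim: i' => [|i' IH] le_ii' H.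
  by move: le_ii' rij; rewrite leqn0 => /eqP ->.
case: (ltngtP i i'.+1) le_ii' => // [lt_i _|<- //].
apply: (@reachable_step i' j); [|lia|lia|by apply: H; lia].
by apply: IH => // k Hk; apply: H; lia.
Qed.

Lemma reachable_right i j j' : reachable i j -> (j <= j')%N ->
  (forall k, (j < k <= j')%N -> g i < h k) -> reachable i j'.
Proof.
move=> rij; elim: j' => [|j' IH] le_jj' H.
  by move: le_jj' rij; rewrite leqn0 => /eqP ->.
case: (ltngtP j j'.+1) le_jj' => // [lt_j _|<- //].
apply: (@reachable_step i j'); [|lia|lia|by apply: H; lia].
by apply: IH => // k Hk; apply: H; lia.
Qed.

Variable n : nat.
Hypothesis gh0 : g 0%N < h 0%N.
Hypothesis g_last : forall i, (i <= n)%N -> g n <= g i.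
Hypothesis h_last : forall j, (j <= n)%N -> h j <= h n.
Hypothesis g_last_lt : forall j, (j <= n)%N -> g n < h j.
Hypothesis h_last_gt : forall i, (i <= n)%N -> g i < h n.
Hypothesis not_stuck : forall k l, (k < n)%N -> (l < n)%N ->
  ~ ((forall j, (j <= l)%N -> h j <= g k) /\
     (forall i, (i <= k)%N -> h l <= g i)).

(* The coordinates of the path are walkers on [g] and on [h].  Both wait at a
   record (a minimum of [g], a maximum of [h]); the one who can reach the next
   weak record without being blocked moves.  If both are blocked, the two
   blocking indices form a stuck pair. *)
Lemma reachable_last : reachable n n.
Proof.
have H0 : reachable 0 0 by exists (fun=> 0%N), (fun=> 0%N), 0%N; split.
have claim : forall m i j, (i + j + m = n + n)%N -> (i <= n)%N -> (j <= n)%N ->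
    reachable i j -> (forall i', (i' <= i)%N -> g i <= g i') ->
    (forall j', (j' <= j)%N -> h j' <= h j) -> reachable n n.
  elim/ltn_ind => m IH i j Em le_in le_jn rij gi hj.
  case: (ltngtP i n) le_in => // [lt_in _|ein _]; last first.
    subst i; apply: (@reachable_right _ j) => // k Hk.
    by apply: g_last_lt; lia.
  case: (ltngtP j n) le_jn => // [lt_jn _|ejn _]; last first.
    subst j; apply: (@reachable_left i) => // [|k Hk]; first exact: ltnW.
    by apply: h_last_gt; lia.
  (* [k] will be the first index after [i] at which [g] leaves the open band between [g i] and
     [h j]: either a weak minimum, to which the walker can move, or a block. [l] is the analogue for
     [h]. *)
  have exk : exists k, (i < k)%N && ((g k <= g i) || (h j <= g k)).
    by exists n; rewrite lt_in g_last // ltnW.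
  have exl : exists l, (j < l)%N && ((h j <= h l) || (h l <= g i)).
    by exists n; rewrite lt_jn h_last // ltnW.
  have gihj : g i < h j.
    case: rij => u [v [M [[_ [<- <-] _] lt_gh]]]; exact: lt_gh.
  case: (ex_minnP exk) => k /andP[ik Pk] mink.
  case: (ex_minnP exl) => l /andP[jl Pl] minl.
  have kn : (k <= n)%N by apply: mink; rewrite lt_in g_last // ltnW.
  have ln : (l <= n)%N by apply: minl; rewrite lt_jn h_last // ltnW.
  have gbet i' : (i < i')%N -> (i' < k)%N -> g i < g i' < h j.
    move=> ii' i'k; rewrite !ltNge -negb_or; apply/negP => H.
    by have := mink i'; rewrite ii' H leqNgt i'k => /(_ isT).
  have hbet j' : (j < j')%N -> (j' < l)%N -> g i < h j' < h j.
    move=> jj' j'l; rewrite !ltNge -negb_or orbC; apply/negP => H.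
    by have := minl j'; rewrite jj' H leqNgt j'l => /(_ isT).
  have [gk|gk] := leP (g k) (g i).
    apply: (IH (n + n - (k + j))%N _ k j) => //; try lia.
    + apply: (@reachable_left i) => //; first exact: ltnW.
      move=> k' /andP[ik' k'k]; case: (ltngtP k' k) k'k => // [k'k _|-> _].
        by case/andP: (gbet k' ik' k'k).
      exact: le_lt_trans gihj.
    + move=> i' i'k; case: (leqP i' i) => [/gi|ii']; first exact: le_trans.
      case: (ltngtP i' k) i'k => // [i'k _|-> //].
      have /andP[/ltW gii' _] := gbet i' ii' i'k.
      exact: le_trans gii'.
  have [hl|hl] := leP (h j) (h l).
    apply: (IH (n + n - (i + l))%N _ i l) => //; try lia.
    + apply: (@reachable_right _ j) => //; first exact: ltnW.
      move=> k' /andP[jk' k'l]; case: (ltngtP k' l) k'l => // [k'l _|-> _].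
        by case/andP: (hbet k' jk' k'l).
      exact: lt_le_trans hl.
    + move=> j' j'l; case: (leqP j' j) => [/hj h1|jj']; first exact: le_trans hl.
      case: (ltngtP j' l) j'l => // [j'l _|-> //].
      have /andP[_ /ltW hjj'] := hbet j' jj' j'l.
      exact: le_trans hl.
  (* Both walkers are blocked. Before [l] the values of [h] are at most [h j <= g k], before [k]
     those of [g] are at least [g i >= h l], so the pair is stuck. *)
  have {}Pk : h j <= g k by move: Pk; rewrite leNgt gk.
  have {}Pl : h l <= g i by move: Pl; rewrite leNgt hl.
  have kn' : (k < n)%N.
    rewrite ltn_neqAle kn andbT; apply/eqP => E.
    by move: gk; rewrite E ltNge g_last // ltnW.
  have ln' : (l < n)%N.
    rewrite ltn_neqAle ln andbT; apply/eqP => E.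
    by move: hl; rewrite E ltNge h_last // ltnW.
  case: (not_stuck kn' ln'); split.
  - move=> j' j'l; case: (leqP j' j) => [/hj h1|jj']; first exact: le_trans Pk.
    case: (ltngtP j' l) j'l => // [j'l _|-> _]; last first.
      by apply: (le_trans Pl); apply: ltW.
    have /andP[_ /ltW hjj'] := hbet j' jj' j'l.
    exact: le_trans Pk.
  - move=> i' i'k; case: (leqP i' i) => [/gi|ii']; first exact: le_trans.
    case: (ltngtP i' k) i'k => // [i'k _|-> _]; last first.
      by apply: (le_trans Pl); apply: ltW.
    have /andP[/ltW gii' _] := gbet i' ii' i'k.
    exact: le_trans gii'.
apply: (claim (n + n)%N 0%N 0%N) => // [i'|j']; rewrite leqn0 => /eqP -> //.
Qed.

End LatticePath.

Lemma path_mono (u : nat -> nat) : (forall k, (u k <= u k.+1 <= (u k).+1)%N) ->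
  forall k l, (k <= l)%N -> (u k <= u l)%N.
Proof.
move=> st k; elim=> [|l IH]; first by rewrite leqn0 => /eqP ->.
rewrite leq_eqVlt ltnS => /orP[/eqP ->//|/IH /leq_trans]; apply.
by case/andP: (st l).
Qed.

(** Unit steps make [u] take every value up to [u M]; any choice of visiting times is strictly
    increasing since [u] is nondecreasing. Only [K 0] is fixed by hand, so that heights start at
    0. *)
Lemma path_first_visits (u : nat -> nat) (M : nat) : u 0%N = 0%N ->
  (forall k, (u k <= u k.+1 <= (u k).+1)%N) ->
  exists K : nat -> nat, [/\ K 0%N = 0%N,
    forall i, (i <= u M)%N -> u (K i) = i &
    forall i, (i < u M)%N -> (K i < K i.+1)%N].
Proof.
move=> u0 st.
have visit m i : (i <= u m)%N -> exists k, u k = i.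
  elim: m => [|m IH]; first by rewrite u0 leqn0 => /eqP ->; exists 0%N.
  move=> le_i; case: (leqP i (u m)) => [/IH //|lt_i].
  by exists m.+1; case/andP: (st m) => ? ?; lia.
have ex i : exists k, (i <= u M)%N -> u k = i.
  by case: (leqP i (u M)) => [/visit [k <-]|_]; [exists k|exists 0%N].
have [K HK] := choice ex.
pose K' i := if i is 0%N then 0%N else K i.
have HK' i : (i <= u M)%N -> u (K' i) = i by case: i => // i; exact: HK.
exists K'; split=> // i lt_i; rewrite ltnNge; apply/negP => le_K.
have := path_mono st le_K; rewrite !HK' //; first by rewrite ltnn.
exact: ltnW.
Qed.

Lemma visit_between (u : nat -> nat) (a b i k : nat) :
  (forall k, (u k <= u k.+1 <= (u k).+1)%N) -> u a = i -> u b = i.+1 ->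
  (a <= k <= b)%N -> (i <= u k <= i.+1)%N.
Proof.
by move=> st ua ub /andP[ak kb]; rewrite -{1}ua -ub !path_mono.
Qed.

(** * Compactness and interpolation on the real line *)

Section Analysis.
Context {R : realType}.

(* The distance is bounded away from 0 on the compact set of pairs whose
   images are at least [eps] apart. *)
Lemma uniformly_continuous_on (U V : normedModType R) (f : U -> V) (A : set U)
    (eps : R) : continuous f -> compact A -> 0 < eps ->
  exists2 delta, 0 < delta &
    forall p q, A p -> A q -> `|p - q| <= delta -> `|f p - f q| <= eps.
Proof.
move=> cf cA eps_gt0.
pose B := (A `*` A) `&` [set pq : U * U | eps <= `|f pq.1 - f pq.2|].
have cdist : continuous (fun pq : U * U => `|f pq.1 - f pq.2|).
  move=> pq; apply: (@cvg_norm _ _ _ _ _ (fun pq : U * U => f pq.1 - f pq.2)).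
  apply: cvgB.
    by apply: continuous_comp; [exact: cvg_fst|exact: cf].
  by apply: continuous_comp; [exact: cvg_snd|exact: cf].
have cB : compact B.
  apply: compact_closedI; first exact: compact_setX.
  exact: (preimage_closed (fun pq _ => cdist pq) (@closed_ge R eps)).
have [B0|] := pselect (B !=set0); last first.
  move=> nB; exists 1 => // p q Ap Aq _; rewrite leNgt; apply/negP => h.
  by apply: nB; exists (p, q); split => //; exact: ltW.
have [|[p q] /set_mem[[/= Ap Aq] fpq] mindist] :=
    @compact_EVT_min _ R (fun pq : U * U => `|pq.1 - pq.2|) B B0 cB.
  apply: continuous_subspaceT => pq.
  apply: (@cvg_norm _ _ _ _ _ (fun pq : U * U => pq.1 - pq.2)).
  by apply: cvgB; [exact: cvg_fst|exact: cvg_snd].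
have dpq : 0 < `|p - q|.
  rewrite normr_gt0 subr_eq0; apply/eqP => epq.
  by move: fpq; rewrite epq subrr normr0 leNgt eps_gt0.
exists (`|p - q| / 2); first by rewrite divr_gt0.
move=> p' q' Ap' Aq' d'; rewrite leNgt; apply/negP => h.
have : `|p - q| <= `|p' - q'|.
  by apply: (mindist (p', q')); rewrite inE; split=> //; exact: ltW.
by lra.
Qed.

(** By induction: the previous function is frozen past [N] and a linear term of slope [K N.+1 - K N]
    is added there. The base case is a line, so [A] increases on all of [R]. *)
Lemma pl_interpolation (K : nat -> R) (N : nat) :
  (forall i, (i < N)%N -> K i < K i.+1) ->
  exists A : R -> R, [/\ continuous A, {homo A : x y / x < y} &
    forall i, (i <= N)%N -> A i%:R = K i].
Proof.
elim: N => [|N IH] KS.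
  exists (fun x => K 0%N + x); split.
  - by move=> x; apply: cvgD; [exact: cvg_cst|exact: cvg_id].
  - by move=> x y xy; rewrite ltrD2l.
  - by move=> i; rewrite leqn0 => /eqP ->; rewrite addr0.
have [i iN|A [cA incA AK]] := IH; first by apply: KS; exact: ltnW.
have slope : 0 < K N.+1 - K N by rewrite subr_gt0 KS.
have cmin : continuous (fun x : R => Num.min x N%:R).
  by move=> x; apply: (@continuous_min R R id (cst N%:R));
    [exact: cvg_id|exact: cvg_cst].
exists (fun x => A (Num.min x N%:R) + (K N.+1 - K N) * (x - Num.min x N%:R)).
split.
- move=> x; apply: cvgD.
    by apply: (@continuous_comp _ _ _ (fun x : R => Num.min x N%:R) A);
      [exact: cmin|exact: cA].
  by apply: cvgM; [exact: cvg_cst|apply: cvgB; [exact: cvg_id|exact: cmin]].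
- move=> x y xy; have [xN|Nx] := ltP x N%:R; last first.
    have Ny : N%:R < y by exact: le_lt_trans xy.
    by rewrite (min_r (ltW Ny)) ltrD2l ltr_pM2l// ltrD2r.
  rewrite subrr mulr0 addr0.
  have [yN|Ny] := leP y N%:R.
    by rewrite subrr mulr0 addr0 incA.
  by apply: (lt_le_trans (incA _ _ xN)); rewrite lerDl mulr_ge0 // ?(ltW slope) // subr_ge0 ltW.
- move=> i; rewrite leq_eqVlt => /orP[/eqP ->|]; last first.
    rewrite ltnS => iN; rewrite min_l ?ler_nat// subrr mulr0 addr0; exact: AK.
  rewrite min_r ?ler_nat// AK// -natr1.
  by rewrite addrAC subrr add0r mulr1 addrC subrK.
Qed.

Lemma nat_cell (N : nat) (s : R) : 0 <= s <= N.+1%:R ->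
  exists2 i, (i <= N)%N & i%:R <= s <= i.+1%:R.
Proof.
elim: N => [|N IH] /andP[s0 sN]; first by exists 0%N => //; rewrite s0.
have [sN'|sN'] := leP s N.+1%:R.
  by have [|i iN Hi] := IH; [rewrite s0|exists i => //; exact: leqW].
by exists N.+1 => //; rewrite sN ltW.
Qed.

(** The minimisers form a compact set, which has a least element. *)
Lemma first_argmin (f : R -> R) (T : R) : continuous f -> 0 <= T ->
  exists x, [/\ 0 <= x <= T, forall t, 0 <= t <= T -> f x <= f t &
    forall t, 0 <= t < x -> f x < f t].
Proof.
move=> cf T0.
have [|m + minm] := @EVT_min R f 0 T T0.
  exact: continuous_subspaceT.
rewrite in_itv /= => mT.
have [|||z + minz] := @compact_EVT_min R R id (`[0, T] `&` [set z | f z <= f m]).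
- by exists m; split => //=; rewrite in_itv.
- apply: compact_closedI; first exact: segment_compact.
  exact: (preimage_closed (fun x _ => cf x) (@closed_le R (f m))).
- by apply: continuous_subspaceT => ?; exact: cvg_id.
rewrite inE /= in_itv /= => -[zT zm].
exists z; split=> // [t tT|t /andP[t0 tz]].
  by apply: (le_trans zm); apply: minm; rewrite in_itv.
rewrite ltNge; apply/negP => ftz.
have : z <= t; last by rewrite leNgt tz.
apply: (minz t); rewrite inE /= in_itv /=; split; last exact: le_trans zm.
by rewrite t0 /= (le_trans (ltW tz)) //; case/andP: zT.
Qed.

End Analysis.

(** * Heights that separate the two halves of the graph *)

Section SeparatingHeight.
Context {R : realType} (f : R -> R).
Hypothesis cf : continuous f.
Hypothesis f0 : f 0 = 0.
Hypothesis f_left : forall x, x <= -1 -> f x = f (-1).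
Hypothesis f_right : forall x, 1 <= x -> f x = f 1.

(** Take the first minimum of [f] on [[0, T]] and the first maximum met when walking left from 0 to
    [- S]. Between these points [f] stays strictly between the two values, because they are first
    and by the hypotheses on the opposite half; the intermediate value theorem fills the
    interval. *)
Lemma stuck_departure (S T : R) : 0 <= S -> 0 <= T ->
  (forall t, 0 <= t <= T -> f t < f (- S)) ->
  (forall s, 0 <= s <= S -> f T < f (- s)) ->
  exists x1 x2, negative_radial_departure f x1 x2.
Proof.
move=> S0 T0 HT HS.
have [x2 [/andP[x20 x2T] min2 first2]] := first_argmin cf T0.
have cnf : continuous (fun s => - f (- s)).
  move=> x; apply: cvgN; apply: (@continuous_comp _ _ _ -%R f); last exact: cf.
  exact: opp_continuous.
have [x1 [/andP[x10 x1S] min1 first1]] := first_argmin cnf S0.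
have fT : f x2 <= f T by apply: min2; rewrite T0 /=.
have fS : f (- S) <= f (- x1) by rewrite -lerN2; apply: min1; rewrite S0 /=.
have f2 : f x2 < 0.
  by apply: (le_lt_trans fT); rewrite -f0 -oppr0 HS ?lexx ?S0.
have f1 : 0 < f (- x1).
  by apply: (lt_le_trans _ fS); rewrite -[ltLHS]f0 HT ?lexx ?T0.
have x2gt0 : 0 < x2.
  by rewrite lt_def x20 andbT; apply/eqP => E; rewrite E f0 ltxx in f2.
have x1gt0 : 0 < x1.
  by rewrite lt_def x10 andbT; apply/eqP => E; rewrite E oppr0 f0 ltxx in f1.
(* Beyond 1 the map is constant, so a minimum found there is already attained at 1. *)
have x2le1 : x2 <= 1.
  rewrite leNgt; apply/negP => x2gt1.
  by have := first2 1; rewrite ler01 x2gt1 (f_right (ltW x2gt1)) ltxx => /(_ isT).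
have x1le1 : x1 <= 1.
  rewrite leNgt; apply/negP => x1gt1.
  have := first1 1; rewrite ler01 x1gt1 (@f_left (- x1)); last by lra.
  by rewrite ltxx => /(_ isT).
exists (- x1), x2; split; [by apply/andP; split; lra|by rewrite x2gt0|].
apply/seteqP; split => [y [x] /=|v /=]; rewrite !in_itv /=.
  move=> /andP[xl xr] <-; have [x0|x0] := leP 0 x.
    rewrite first2 ?x0//=; apply: (lt_le_trans _ fS); apply: HT.
    by apply/andP; split => //; exact: ltW (lt_le_trans xr x2T).
  apply/andP; split.
    apply: (le_lt_trans fT); rewrite -[x]opprK; apply: HS.
    by apply/andP; split; lra.
  have := first1 (- x); rewrite opprK ltrN2; apply.
  by apply/andP; split; lra.
move=> /andP[vl vr].
have [|||z] := @IVT R f (- x1) x2 v.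
- by lra.
- exact: continuous_subspaceT.
- by rewrite ge_min le_max (ltW vl) (ltW vr) orbT.
rewrite in_itv /= => /andP[zl zr] fz; exists z => //; rewrite in_itv /=.
rewrite !lt_def zl zr !andbT; apply/andP; split; apply/eqP => E.
  by move: vr; rewrite -fz E ltxx.
by move: vl; rewrite -fz E ltxx.
Qed.

Hypothesis f_bound : forall x, `|f x| <= 1.
Hypothesis no_departure : forall x1 x2, ~ negative_radial_departure f x1 x2.

(* The heights come from a lattice path of pairs of grid points [(- i d, j d)]
   along which [f (- i d) < f (j d)] up to [c / 2]: the height of a grid point
   is the time at which the path first visits it.  The extra last index, with
   values out of the range of [f], lets the path end with both walkers at
   their strict records. *)
Lemma separating_height (c : R) : 0 < c ->
  exists a : R -> R, [/\ continuous a /\ a 0 = 0,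
    forall x y : R, 0 <= x < y -> a x < a y,
    forall x y : R, x < y <= 0 -> a y < a x,
    forall x, `|x| <= 2 -> a x <= c &
    forall z z' : R, -2 <= z' <= 0 -> 0 <= z <= 2 -> a z = a z' ->
      f z' < f z + c].
Proof.
move=> c_gt0.
have [||del del0 Hdel] := @uniformly_continuous_on R R R f `[-2, 2]%classic (c / 8) cf.
- exact: segment_compact.
- by lra.
have [N HN] : exists N : nat, 2 / N.+1%:R <= del.
  exists (Num.truncn (2 / del)).
  rewrite ler_pdivrMr ?ltr0n// mulrC -ler_pdivrMr//.
  by apply: ltW; exact: truncnS_gt.
pose d : R := 2 / N.+1%:R.
have d0 : 0 < d by rewrite divr_gt0 ?ltr0n.
have dN : N.+1%:R * d = 2 by rewrite /d mulrC divfK // pnatr_eq0.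
have grid i : (i <= N.+1)%N -> 0 <= i%:R * d <= 2.
  move=> iN; rewrite mulr_ge0 ?ler0n ?(ltW d0)//=.
  by rewrite -dN ler_wpM2r ?ler_nat ?(ltW d0).
have osc x y : 0 <= x <= 2 -> 0 <= y <= 2 -> `|x - y| <= d ->
    `|f x - f y| <= c / 8 /\ `|f (- x) - f (- y)| <= c / 8.
  move=> x2 y2 xy; have {}xy := le_trans xy HN.
  split; apply: Hdel => //=; rewrite ?in_itv/=; try by apply/andP; split; lra.
  by rewrite opprK addrC distrC.
have cell s i i' : i%:R <= s <= i.+1%:R -> (i <= i' <= i.+1)%N ->
    `|s * d - i'%:R * d| <= d.
  move=> /andP[si si'] ii'; rewrite -mulrBl normrM (gtr0_norm d0).
  rewrite ler_piMl ?(ltW d0)// ler_norml.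
  have [->|->] : i' = i \/ i' = i.+1 by lia.
    by rewrite -natr1 in si'; apply/andP; split; lra.
  by rewrite -natr1 in si' *; apply/andP; split; lra.
(* The shifts by [c / 4] exceed the oscillation [c / 8] of a cell, so a stuck pair gives strict
   inequalities on whole intervals; the final error [c / 2 + 2 * (c / 8)] is still below [c]. *)
pose g i := if (i <= N.+1)%N then f (- (i%:R * d)) - c / 4 else - (2 + c).
pose h j := if (j <= N.+1)%N then f (j%:R * d) + c / 4 else 2 + c.
have fb x : -1 <= f x <= 1 by rewrite -ler_norml.
have gb i : - (2 + c) <= g i < 2 + c.
  by rewrite /g; case: ifP => _; have := fb (- (i%:R * d)); lra.
have hb i : - (2 + c) < h i <= 2 + c.
  by rewrite /h; case: ifP => _; have := fb (i%:R * d); lra.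
have gn : g N.+2 = - (2 + c) by rewrite /g ltnn.
have hn : h N.+2 = 2 + c by rewrite /h ltnn.
have [||||||u [v [M [[[u0 v0] [uM vM] st] lt_gh]]]] := @reachable_last R g h N.+2.
- by rewrite /g /h /= mul0r oppr0 f0; lra.
- by move=> i _; rewrite gn; case/andP: (gb i).
- by move=> i _; rewrite hn; case/andP: (hb i).
- by move=> i _; rewrite gn; case/andP: (hb i).
- by move=> i _; rewrite hn; case/andP: (gb i).
- move=> k l; rewrite !ltnS => kN lN [Hk Hl].
  have [k0 k2] := andP (grid _ kN); have [l0 l2] := andP (grid _ lN).
  have cell_of s m : (m <= N.+1)%N -> 0 <= s <= m%:R * d ->
      exists2 i, (i <= m)%N & `|s - i%:R * d| <= d.
    move=> mN /andP[s0 sm].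
    have [|i im Hi] := @nat_cell R m (s / d).
      rewrite divr_ge0 ?(ltW d0)//= ler_pdivrMr//; apply: (le_trans sm).
      by rewrite ler_pM2r// ler_nat.
    exists i => //; have := cell _ _ i Hi; rewrite leqnn leqnSn => /(_ isT).
    by rewrite divfK // gt_eqF.
  have [||x1 [x2 /no_departure //]] := stuck_departure k0 l0.
  + move=> t /andP[t0 tl].
    have [j jl tj] := cell_of t l lN (introT andP (conj t0 tl)).
    have jN := leq_trans jl lN.
    have [|+ _] := osc t (j%:R * d) _ (grid _ jN) tj.
      by rewrite t0 (le_trans tl).
    have := Hk _ jl; rewrite /g /h kN jN ler_norml => ? /andP[? ?]; lra.
  + move=> s /andP[s0 sk].
    have [i ik si] := cell_of s k kN (introT andP (conj s0 sk)).
    have iN := leq_trans ik kN.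
    have [|_ +] := osc s (i%:R * d) _ (grid _ iN) si.
      by rewrite s0 (le_trans sk).
    have := Hl _ ik; rewrite /g /h lN iN ler_norml => ? /andP[? ?]; lra.
have stu k := (st k).1; have stv k := (st k).2.
have [KL [KL0 uKL KLS]] := path_first_visits M u0 stu.
have [KR [KR0 vKR KRS]] := path_first_visits M v0 stv.
rewrite uM in uKL KLS; rewrite vM in vKR KRS.
have [|AL [cAL incAL ALK]] := @pl_interpolation R (fun i => (KL i)%:R) N.+2.
  by move=> i iN; rewrite ltr_nat KLS.
have [|AR [cAR incAR ARK]] := @pl_interpolation R (fun i => (KR i)%:R) N.+2.
  by move=> i iN; rewrite ltr_nat KRS.
have AL0 : AL 0 = 0 by rewrite -[0](mulr0n 1) ALK// KL0.
have AR0 : AR 0 = 0 by rewrite -[0](mulr0n 1) ARK// KR0.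
have lec (A : R -> R) : {homo A : x y / x < y} -> forall x y, x <= y -> A x <= A y.
  by move=> incA x y; rewrite le_eqVlt => /orP[/eqP ->//|/incA/ltW].
have B0 : 0 < AR N.+1%:R + AL N.+1%:R.
  by apply: addr_gt0; [rewrite -[ltLHS]AR0 incAR|rewrite -[ltLHS]AL0 incAL]; rewrite ?ltr0n.
pose B := AR N.+1%:R + AL N.+1%:R.
have lam0 : 0 < c / B by rewrite divr_gt0.
(* [AL] and [AR] vanish at 0, so each half line sees one term only; [B] bounds both on [[0, N.+1]],
   hence the factor [c / B]. *)
pose a (z : R) : R := c / B * (AR (Num.max z 0 / d) + AL (Num.max (- z) 0 / d)).
have aR (z : R) : 0 <= z -> a z = c / B * AR (z / d).
  by move=> z0; rewrite /a max_l// max_r ?oppr_le0// mul0r AL0 addr0.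
have aL (z : R) : z <= 0 -> a z = c / B * AL (- z / d).
  by move=> z0; rewrite /a max_r// max_l ?oppr_ge0// mul0r AR0 add0r.
have cmax (w A : R -> R) : continuous w -> continuous A ->
    continuous (fun z : R => A (Num.max (w z) 0 / d)).
  move=> cw cA z.
  apply: (@continuous_comp _ _ _ (fun z : R => Num.max (w z) 0 / d) A _ _ (cA _)).
  apply: cvgM; last exact: cvg_cst.
  by apply: (@continuous_max R R w (cst 0)); [exact: cw|exact: cvg_cst].
exists a; split.
- split; last by rewrite aR// mul0r AR0 mulr0.
  move=> z; apply: cvgM; first exact: cvg_cst.
  apply: cvgD; first by apply: (cmax id) => // ?; exact: cvg_id.
  by apply: (cmax -%R) => // ?; exact: opp_continuous.
- move=> x y /andP[x0 xy]; rewrite !aR//; last exact: ltW (le_lt_trans x0 xy).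
  by rewrite ltr_pM2l// incAR// ltr_pM2r// invr_gt0.
- move=> x y /andP[xy y0]; rewrite !aL//; last exact: ltW (lt_le_trans xy y0).
  by rewrite ltr_pM2l// incAL// ltr_pM2r ?invr_gt0// ltrN2.
- move=> x; rewrite ler_norml => /andP[xl xr].
  have -> : c = c / B * B by rewrite divfK// gt_eqF.
  have NB (A : R -> R) z : {homo A : x y / x < y} -> z <= 2 -> A (z / d) <= A N.+1%:R.
    by move=> incA z2; apply: lec => //; rewrite ler_pdivrMr// dN.
  have [x0|/ltW x0] := leP 0 x.
    by rewrite aR// ler_pM2l// /B ler_wpDr ?NB// -[leLHS]AL0 lec.
  rewrite aL// ler_pM2l// /B ler_wpDl ?NB//; last by lra.
    by rewrite -[leLHS]AR0 lec.
move=> z z' /andP[z'l z'0] /andP[z0 zr]; rewrite aR// aL// => /mulfI.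
rewrite gt_eqF// => /(_ isT) eqA.
have scaled w : 0 <= w <= 2 -> exists2 i, (i <= N)%N & i%:R <= w / d <= i.+1%:R.
  move=> /andP[w0 w2]; apply: nat_cell; rewrite divr_ge0 ?(ltW d0)//=.
  by rewrite ler_pdivrMr// dN.
have [|i iN Hi] := scaled (- z'); first by apply/andP; split; lra.
have [|j jN Hj] := scaled z; first by rewrite z0.
have [Hi1 Hi2] := andP Hi; have [Hj1 Hj2] := andP Hj.
have iN2 : (i.+1 <= N.+2)%N by rewrite ltnW.
have jN2 : (j.+1 <= N.+2)%N by rewrite ltnW.
have Li1 := lec _ incAL _ _ Hi1; have Li2 := lec _ incAL _ _ Hi2.
have Rj1 := lec _ incAR _ _ Hj1; have Rj2 := lec _ incAR _ _ Hj2.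
rewrite (ALK _ (ltnW iN2)) in Li1; rewrite (ALK _ iN2) -eqA in Li2.
rewrite (ARK _ (ltnW jN2)) eqA in Rj1; rewrite (ARK _ jN2) eqA in Rj2.
rewrite -eqA in Li1 Rj1 Rj2.
have Lij : (KL i <= KR j.+1)%N by rewrite -(ler_nat R) (le_trans Li1).
have Rji : (KR j <= KL i.+1)%N by rewrite -(ler_nat R) (le_trans Rj1).
have Lii : (KL i < KL i.+1)%N by exact: KLS iN2.
have Rjj : (KR j < KR j.+1)%N by exact: KRS jN2.
(* The time intervals of the two cells share a real point, so the larger left end is an integer time
   lying in both. At that time each walker is at an end of its cell. *)
pose k := maxn (KL i) (KR j).
have ui : (i <= u k <= i.+1)%N.
  apply: (visit_between stu (uKL _ (ltnW iN2)) (uKL _ iN2)).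
  by rewrite leq_maxl geq_max (ltnW Lii).
have vj : (j <= v k <= j.+1)%N.
  apply: (visit_between stv (vKR _ (ltnW jN2)) (vKR _ jN2)).
  by rewrite leq_maxr geq_max (ltnW Rjj) Lij.
have uN : (u k <= N.+1)%N by case/andP: ui => _ /leq_trans; apply.
have vN : (v k <= N.+1)%N by case/andP: vj => _ /leq_trans; apply.
have := lt_gh k; rewrite /g /h uN vN.
have dE w : w / d * d = w by rewrite divfK // gt_eqF.
have [||_ +] := osc (- z') ((u k)%:R * d) _ (grid _ uN).
- by apply/andP; split; lra.
- by rewrite -(dE (- z')); apply: cell Hi ui.
have [||+ _] := osc z ((v k)%:R * d) _ (grid _ vN).
- by rewrite z0.
- by rewrite -(dE z); apply: cell Hj vj.
rewrite opprK !ler_norml => /andP[? ?] /andP[? ?] ?; lra.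
Qed.

End SeparatingHeight.

(** * Folding a box into a thin strip *)

Section FoldedBox.
Context {R : realType}.

Lemma pair_norm_le (p : R * R) (r : R) :
  (`|p| <= r) = (`|p.1| <= r) && (`|p.2| <= r).
Proof. by rewrite prod_normE ge_max. Qed.

Lemma continuous_pair (T : topologicalType) (u v : T -> R) :
  continuous u -> continuous v -> continuous (fun x => (u x, v x)).
Proof. by move=> cu cv x; exact: (cvg_pair (cu x) (cv x)). Qed.

(** For [eta = 1] this is the retraction of the line onto [[-1, 1]] by which the bonding maps are
    extended. *)
Definition ramp (eta x : R) := Num.max (-1) (Num.min 1 (x / eta)).

Lemma rampP (eta x : R) : 0 < eta ->
  [\/ [/\ `|x| < eta, x = eta * ramp eta x & `|ramp eta x| < 1],
      eta <= x /\ ramp eta x = 1 | x <= - eta /\ ramp eta x = -1].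
Proof.
move=> eta0; rewrite /ramp.
have [x1|x1] := leP eta x.
  constructor 2; split=> //; rewrite min_l; first by rewrite max_r//; lra.
  by rewrite ler_pdivlMr// mul1r.
have [x2|x2] := leP x (- eta).
  constructor 3; split=> //; rewrite max_l// ge_min; apply/orP; right.
  by rewrite ler_pdivrMr// mulN1r.
have lt1 : x / eta < 1 by rewrite ltr_pdivrMr// mul1r.
have lt2 : -1 < x / eta by rewrite ltr_pdivlMr// mulN1r.
constructor 1; rewrite min_r ?(ltW lt1)// max_r ?(ltW lt2)//; split.
- by rewrite ltr_norml x1 x2.
- by rewrite mulrC divfK// gt_eqF.
- by rewrite ltr_norml lt1 lt2.
Qed.

Lemma ramp_le1 (eta x : R) : 0 < eta -> `|ramp eta x| <= 1.
Proof.
by move=> /(rampP x)[[_ _ /ltW]//|[_ ->]|[_ ->]]; rewrite ?normrN normr1.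
Qed.

Lemma continuous_ramp (eta : R) : continuous (ramp eta).
Proof.
move=> x; apply: (@continuous_max R R (cst (-1)) (fun x : R => Num.min 1 (x / eta))).
  exact: cvg_cst.
apply: (@continuous_min R R (cst 1) (fun x : R => x / eta)); first exact: cvg_cst.
by apply: cvgM; [exact: cvg_id|exact: cvg_cst].
Qed.

(* The box is mapped to a thin strip along the curve [x |-> (f x, a x)]: near
   the origin the strip is a V, below which the vertical ray stays free, and
   beyond it the points of the curve with the same height [a] are kept apart
   horizontally by [sep]. *)
Lemma folding (f a : R -> R) (c eta : R) :
  continuous f -> f 0 = 0 -> continuous a -> a 0 = 0 -> 0 < c -> 0 < eta ->
  (forall x y : R, 0 <= x < y -> a x < a y) ->
  (forall x y : R, x < y <= 0 -> a y < a x) ->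
  (forall x, `|x| <= 2 -> a x <= c) ->
  (forall z z' : R, -2 <= z' <= 0 -> 0 <= z <= 2 -> a z = a z' -> f z' < f z + c) ->
  (forall x y, `|x| <= 2 -> `|y| <= 2 -> `|x - y| <= eta -> `|f x - f y| <= c) ->
  exists G : R * R -> R * R,
    [/\ continuous G,
        forall p q, `|p| <= 2 -> `|q| <= 2 -> G p = G q -> p = q,
        forall p, `|p| <= 2 -> `|G p - (f p.1, 0)| <= 3 * c,
        G (0, 0) = (0, 0) &
        forall p, `|p| <= 2 -> (G p).1 = 0 -> (G p).2 <= 0 ->
          p.1 = 0 /\ p.2 <= 0].
Proof.
move=> cf f0 ca a0 c0 eta0 incA decA leA sep osc.
(* [k] collapses the central interval to 0 and shifts the outer parts to meet there. *)
pose t : R -> R := ramp eta; pose k (x : R) : R := x - eta * t x.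
have ct : continuous t := @continuous_ramp eta.
have ck : continuous k.
  move=> x; apply: cvgB; first exact: cvg_id.
  by apply: cvgM; [exact: cvg_cst|exact: ct].
(* In the centre, lines of constant [y] become Vs [Y = |X| + c / 4 * y]. Outside, vertical segments
   become horizontal ones at height [c + a (k x)], at distance [c / 2] to [3 * c / 2] from
   [f (k x)], on the right for [x > 0] and on the left for [x < 0]. *)
pose X (p : R * R) : R := t p.1 * (c - c / 4 * p.2) + f (k p.1).
pose Y (p : R * R) : R := c * `|t p.1| + c / 4 * (1 - `|t p.1|) * p.2 + a (k p.1).
have c1 (u : R -> R) : continuous u -> continuous (fun p : R * R => u p.1).
  by move=> cu p; apply: continuous_comp; [exact: cvg_fst|exact: cu].
have kP (x : R) : `|x| <= 2 -> [\/ `|x| < eta /\ k x = 0,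
    [/\ eta <= x, t x = 1, 0 <= k x <= 2 & k x = x - eta] |
    [/\ x <= - eta, t x = -1, -2 <= k x <= 0 & k x = x + eta]].
  rewrite ler_norml => /andP[x1 x2]; rewrite /k.
  case: (rampP x eta0) => [[h e _]|[h e]|[h e]].
  - by constructor 1; split=> //; rewrite {1}e subrr.
  - by constructor 2; rewrite /t e mulr1; split=> //; apply/andP; split; lra.
  - by constructor 3; rewrite /t e mulrN1 opprK; split=> //; apply/andP; split; lra.
have k2 (x : R) : `|x| <= 2 -> `|k x| <= 2.
  move=> /kP [[_ ->]|[_ _ ? _]|[_ _ ? _]]; rewrite ?normr0// ler_norml; lra.
have a_ge0 (x : R) : 0 <= a x.
  have [x0|x0|->] := ltgtP x 0; last by rewrite a0.
    by rewrite -a0 ltW// decA// x0 /=.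
  by rewrite -a0 ltW// incA// x0 lexx.
have tle (x : R) : `|t x| <= 1 := ramp_le1 x eta0.
have wide (y : R) : `|y| <= 2 -> c / 2 <= c - c / 4 * y <= c + c / 2.
  by rewrite ler_norml => /andP[? ?]; apply/andP; split; nra.
(* The set [Y < c] is the image of the central part [|x| < eta]. *)
have outer (x y : R) : eta <= `|x| -> `|x| <= 2 -> Y (x, y) = c + a (k x).
  move=> ex /kP[[xe _]|[_ tx _ _]|[_ tx _ _]]; first by lra.
    by rewrite /Y /= tx normr1; ring.
  by rewrite /Y /= tx normrN normr1; ring.
have inner (x : R) : `|x| < eta -> k x = 0 /\ `|t x| < 1.
  rewrite /k /t => xe; case: (rampP x eta0) => [[_ e h]|[h e]|[h e]].
  - by split=> //; rewrite {1}e subrr.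
  - by move: xe; rewrite ltr_norml => /andP[? ?]; lra.
  - by move: xe; rewrite ltr_norml => /andP[? ?]; lra.
have innerY (x y : R) : `|x| < eta -> `|y| <= 2 -> Y (x, y) < c.
  move=> /inner[kx tx]; rewrite ler_norml /Y /= kx a0 => /andP[? ?].
  have P : 0 < c * (1 - `|t x|) by rewrite mulr_gt0// subr_gt0.
  have Q : 0 <= c * (1 - `|t x|) * (2 - y) by rewrite mulr_ge0 ?(ltW P)//; lra.
  lra.
have innerE (x y : R) : `|x| < eta -> `|y| <= 2 ->
    X (x, y) = t x * (c - c / 4 * y) /\ Y (x, y) - `|X (x, y)| = c / 4 * y.
  move=> /inner[kx tx] /wide/andP[wy _]; rewrite /X /Y /= kx a0 f0 !addr0.
  split=> //; rewrite normrM (@ger0_norm _ (c - _)); last by lra.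
  by ring.
exists (fun p => (X p, Y p)); split.
- apply: continuous_pair => p.
    apply: cvgD; last by apply: (c1 (f \o k)) => x; apply: continuous_comp; [exact: ck|exact: cf].
    apply: cvgM; first exact: (c1 t).
    apply: cvgB; first exact: cvg_cst.
    by apply: cvgM; [exact: cvg_cst|exact: cvg_snd].
  have cnt : continuous (fun x => `|t x|) by move=> x; apply: cvg_norm; exact: ct.
  apply: cvgD; last by apply: (c1 (a \o k)) => x; apply: continuous_comp; [exact: ck|exact: ca].
  apply: cvgD; first by apply: cvgM; [exact: cvg_cst|exact: (c1 _ cnt)].
  apply: cvgM; last exact: cvg_snd.
  apply: cvgM; first exact: cvg_cst.
  by apply: cvgB; [exact: cvg_cst|exact: (c1 _ cnt)].
- move=> [x y] [x' y']; rewrite !pair_norm_le /= => /andP[x2 y2] /andP[x2' y2'].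
  move=> [eX eY]; have /andP[wy1 wy2] := wide _ y2; have /andP[wy1' wy2'] := wide _ y2'.
  have [xe|xe] := ltP `|x| eta; have [xe'|xe'] := ltP `|x'| eta.
  (* [Y - |X|] determines [y], then [X] determines [t x], and [x = eta * t x] in the centre. *)
  + have [EX EY] := innerE _ _ xe y2; have [EX' EY'] := innerE _ _ xe' y2'.
    have yy : y = y'.
      move: EY; rewrite eX eY EY' => /mulfI -> //.
      by rewrite gt_eqF//; lra.
    subst y'; move: EX; rewrite eX EX' => /mulIf tt.
    have {}tt : t x = t x' by rewrite tt// gt_eqF//; lra.
    have [kx _] := inner _ xe; have [kx' _] := inner _ xe'.
    by move: kx kx'; rewrite /k tt => /subr0_eq xE /subr0_eq xE'; rewrite xE -xE'.
  + exfalso; have := innerY _ y xe y2; rewrite eY outer//; have := a_ge0 (k x'); lra.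
  + exfalso; have := innerY _ y' xe' y2'; rewrite -eY outer//; have := a_ge0 (k x); lra.
  have eA : a (k x) = a (k x') by move: eY; rewrite !outer//; lra.
  move: eX; rewrite /X /=.
  case: (kP _ x2) => [[h _]|[h tx kx ex]|[h tx kx ex]]; first by exfalso; lra.
    case: (kP _ x2') => [[h' _]|[h' tx' kx' ex']|[h' tx' kx' ex']]; first by exfalso; lra.
      have kk : k x = k x'.
        have [l|l|//] := ltgtP (k x) (k x').
          by have := incA (k x) (k x'); rewrite eA ltxx l; case/andP: kx => -> _ /(_ isT).
        by have := incA (k x') (k x); rewrite eA ltxx l; case/andP: kx' => -> _ /(_ isT).
      rewrite tx tx' kk => eX; have -> : x = x' by lra.
      by congr (_, _); nra.
    (* At equal heights the left segment ends at [f (k x') - c / 2] and the right one starts at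
       [f (k x) + c / 2]; [sep] puts the former first. *)
    by rewrite tx tx' => eX; exfalso; have := sep _ _ kx' kx eA; lra.
  case: (kP _ x2') => [[h' _]|[h' tx' kx' ex']|[h' tx' kx' ex']]; first by exfalso; lra.
    by rewrite tx tx' => eX; exfalso; have := sep _ _ kx kx' (esym eA); lra.
  have kk : k x = k x'.
    have [l|l|//] := ltgtP (k x) (k x').
      by have := decA (k x) (k x'); rewrite eA ltxx l; case/andP: kx' => _ -> /(_ isT).
    by have := decA (k x') (k x); rewrite eA ltxx l; case/andP: kx => _ -> /(_ isT).
  rewrite tx tx' kk => eX; have -> : x = x' by lra.
  by congr (_, _); nra.
- move=> [x y]; rewrite pair_norm_le /= => /andP[x2 y2].
  have /andP[wy1 wy2] := wide _ y2.
  have fk : `|f (k x) - f x| <= c.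
    apply: osc => //; first exact: k2.
    by rewrite /k addrAC subrr add0r normrN normrM gtr0_norm// ler_piMr// ltW.
  rewrite pair_norm_le /= subr0 /X /Y /=; apply/andP; split.
    have w0 : 0 <= c - c / 4 * y by apply: le_trans wy1; rewrite divr_ge0 ?(ltW c0).
    rewrite -addrA (le_trans (ler_normD _ _))// normrM (ger0_norm w0).
    have : `|t x| * (c - c / 4 * y) <= c - c / 4 * y by rewrite ler_piMl.
    by lra.
  have P : 0 <= c * (1 - `|t x|) by rewrite mulr_ge0 ?(ltW c0)// subr_ge0 tle.
  have Q : 0 <= c * `|t x| by rewrite mulr_ge0 ?(ltW c0).
  move: y2; rewrite !ler_norml => /andP[y1 y2].
  have P1 : 0 <= c * (1 - `|t x|) * (2 - y) by apply: mulr_ge0 => //; lra.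
  have P2 : 0 <= c * (1 - `|t x|) * (2 + y) by apply: mulr_ge0 => //; lra.
  have := a_ge0 (k x); have := leA _ (k2 _ x2).
  by move=> ? ?; apply/andP; split; lra.
- have [] := innerE 0 0; rewrite ?normr0// => EX EY.
  have t0 : t 0 = 0 by rewrite /t /ramp mul0r min_r// max_r//; lra.
  move: EX; rewrite t0 mul0r => EX; move: EY; rewrite EX normr0 mulr0 subr0 => EY.
  by rewrite EY.
- move=> [x y]; rewrite pair_norm_le /= => /andP[x2 y2] X0 Y0.
  have /andP[wy1 wy2] := wide _ y2.
  have [xe|xe] := ltP `|x| eta; last first.
    by move: Y0; rewrite outer//; have := a_ge0 (k x); lra.
  (* With [X = 0], [Y = c / 4 * y] gives the sign of [y], and positivity of [c - c / 4 * y] forces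
     [t x = 0]. *)
  have [EX EY] := innerE _ _ xe y2; move: EY; rewrite X0 normr0 subr0 => EY.
  split; last by nra.
  have [kx _] := inner _ xe; move: EX; rewrite X0 => /esym/eqP; rewrite mulf_eq0.
  rewrite [X in _ || X]gt_eqF ?orbF; last by lra.
  by move=> /eqP tx; move: kx; rewrite /k tx mulr0 subr0.
Qed.

End FoldedBox.

(** * Injective planar approximations of one bonding map *)

Section ApproximatingFold.
Context {R : realType}.

(** Radius 2 leaves room for the errors: if [f] is bounded by 1 and [delta <= 1], the box is mapped
    into itself. *)
Definition fold_of (f : R -> R) (delta : R) (G : R * R -> R * R) :=
  [/\ continuous G,
      forall p q, `|p| <= 2 -> `|q| <= 2 -> G p = G q -> p = q,
      forall p, `|p| <= 2 -> `|G p - (f p.1, 0)| <= delta,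
      G (0, 0) = (0, 0) &
      forall p, `|p| <= 2 -> (G p).1 = 0 -> (G p).2 <= 0 ->
        p.1 = 0 /\ p.2 <= 0].

Lemma fold_exists (f : R -> R) (delta : R) : continuous f -> f 0 = 0 ->
  (forall x, x <= -1 -> f x = f (-1)) -> (forall x, 1 <= x -> f x = f 1) ->
  (forall x, `|f x| <= 1) ->
  ~ ((exists x1 x2, positive_radial_departure f x1 x2) /\
     (exists x1 x2, negative_radial_departure f x1 x2)) ->
  0 < delta -> exists G, fold_of f delta G.
Proof.
move=> cf f0 fl fr fb nboth delta0.
have ball2 : compact (`[-2, 2]%classic : set R) by exact: segment_compact.
have no_neg (g : R -> R) : continuous g -> g 0 = 0 ->
    (forall x, x <= -1 -> g x = g (-1)) -> (forall x, 1 <= x -> g x = g 1) ->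
    (forall x, `|g x| <= 1) -> (forall x1 x2, ~ negative_radial_departure g x1 x2) ->
    exists G, fold_of g delta G.
  move=> cg g0 gl gr gb ng; pose c := delta / 3.
  have c0 : 0 < c by rewrite divr_gt0.
  have [eta eta0 Heta] := uniformly_continuous_on cg ball2 c0.
  have [a [[ca a0] incA decA leA sep]] := separating_height cg g0 gl gr gb ng c0.
  have [x y x2 y2 xy|G] := folding cg g0 ca a0 c0 eta0 incA decA leA sep.
    by apply: Heta => //=; rewrite in_itv /= -ler_norml.
  rewrite /c mulrC divfK; last by rewrite pnatr_eq0.
  by exists G.
have [neg|noneg] := pselect (exists x1 x2, negative_radial_departure f x1 x2); last first.
  by apply: no_neg => // x1 x2 h; apply: noneg; exists x1, x2.
(* Here [f] has a negative departure, hence no positive one. Reflecting the domain exchanges the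
   orientations and preserves the ray. *)
have [|||||x1 x2 [h1 h2 h3]|G [cG iG aG G0 rG]] := no_neg (fun x => f (- x)).
- move=> x; apply: (@continuous_comp _ _ _ -%R f); last exact: cf.
  exact: opp_continuous.
- by rewrite oppr0.
- by move=> x x1; rewrite opprK fr// lerNr.
- by move=> x x1; rewrite fl// lerNl opprK.
- by move=> x; exact: fb.
- apply: nboth; split=> //; exists (- x2), (- x1); split; [by move: h2 {h3}; lra|by move: h1 {h3}; lra|].
  rewrite -h3 {h3}; apply/seteqP; split => [_ [x + <-]|_ [x + <-]] /=.
    rewrite /= in_itv /= => /andP[? ?]; exists (- x); last by rewrite opprK.
    by rewrite /= in_itv /=; apply/andP; split; lra.
  rewrite /= in_itv /= => /andP[? ?]; exists (- x) => //.
  by rewrite /= in_itv /=; apply/andP; split; lra.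
have normE (p : R * R) : `|(- p.1, p.2)| = `|p| by rewrite !prod_normE /= normrN.
exists (fun p => G (- p.1, p.2)); split.
- move=> p; apply: (@continuous_comp _ _ _ (fun p : R * R => (- p.1, p.2)) G); last exact: cG.
  apply: continuous_pair => q; last exact: cvg_snd.
  by apply: cvgN; exact: cvg_fst.
- move=> [x y] [x' y'] p2 q2 GE.
  have nx : `|(- x, y)| <= 2 by rewrite (normE (x, y)).
  have nx' : `|(- x', y')| <= 2 by rewrite (normE (x', y')).
  by have [/oppr_inj -> ->] := iG _ _ nx nx' GE.
- by move=> p p2; have := aG (- p.1, p.2); rewrite normE /= opprK; apply.
- by rewrite /= oppr0.
- move=> p p2 G1 G2; have [|/= p1 ?] := rG (- p.1, p.2) _ G1 G2.
    by rewrite normE.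
  by split=> //; rewrite -[p.1]opprK p1 oppr0.
Qed.

End ApproximatingFold.

(** * Choosing the folds relative to adapted metrics *)

Section Tower.
Context {R : realType}.

Definition axis (f : R -> R) (p : R * R) : R * R := (f p.1, 0).

(** Metrics uniformly equivalent on the box to the norm distance. The last clause is what allows a
    fold to be chosen close in [e]. *)
Definition admissible (e : R * R -> R * R -> R) :=
  [/\ forall p q, `|p - q| <= e p q,
      forall p, e p p = 0,
      forall p q, e p q = e q p,
      forall p q r, e p r <= e p q + e q r &
      forall eps, 0 < eps -> exists2 delta, 0 < delta &
        forall p q, `|p| <= 2 -> `|q| <= 2 -> `|p - q| <= delta -> e p q <= eps].

(** The least function above the norm distance for which [F] and [G] are 1-Lipschitz into [e];
    errors then pass down a level without growing. *)
Definition refine (e : R * R -> R * R -> R) (F G : R * R -> R * R) p q :=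
  Num.max `|p - q| (Num.max (e (G p) (G q)) (e (F p) (F q))).

Lemma refine_le (e : R * R -> R * R -> R) (F G : R * R -> R * R) p q x :
  (refine e F G p q <= x) =
  [&& `|p - q| <= x, e (G p) (G q) <= x & e (F p) (F q) <= x].
Proof. by rewrite /refine ge_max [X in _ && X]ge_max. Qed.

Lemma compact_box : compact [set p : R * R | `|p| <= 2].
Proof.
have -> : [set p : R * R | `|p| <= 2] = `[-2, 2]%classic `*` `[-2, 2]%classic.
  apply/seteqP; split => p /=; rewrite !in_itv /= -!ler_norml pair_norm_le.
    by move=> /andP[].
  by move=> [-> ->].
by apply: compact_setX; exact: segment_compact.
Qed.

Lemma admissible_dist : admissible (fun p q => `|p - q|).
Proof.
split=> //; [by move=> p; rewrite subrr normr0|exact: distrC|by move=> p q r; exact: (ler_distD q)|].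
by move=> eps eps0; exists eps.
Qed.

Lemma admissible_refine (e : R * R -> R * R -> R) (F G : R * R -> R * R) :
  admissible e -> continuous F -> continuous G ->
  (forall p, `|p| <= 2 -> `|F p| <= 2) -> (forall p, `|p| <= 2 -> `|G p| <= 2) ->
  admissible (refine e F G).
Proof.
move=> [e_ge e0 eC eD eU] cF cG FB GB; split.
- by move=> p q; rewrite /refine le_max lexx.
- by move=> p; rewrite /refine !e0 subrr normr0 !maxxx.
- by move=> p q; rewrite /refine distrC (eC (G p)) (eC (F p)).
- move=> p q r; rewrite refine_le; apply/and3P; rewrite /refine; split.
  + by apply: (le_trans (ler_distD q p r)); apply: lerD; rewrite le_max lexx.
  + by apply: (le_trans (eD _ (G q) _)); apply: lerD; rewrite !le_max lexx ?orbT.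
  + by apply: (le_trans (eD _ (F q) _)); apply: lerD; rewrite !le_max lexx ?orbT.
move=> eps eps0; have [d d0 Hd] := eU _ eps0.
have [dF dF0 HF] := uniformly_continuous_on cF compact_box d0.
have [dG dG0 HG] := uniformly_continuous_on cG compact_box d0.
exists (Num.min eps (Num.min dF dG)); first by rewrite !lt_min eps0 dF0.
move=> p q p2 q2; rewrite !le_min => /and3P[? ? ?].
rewrite refine_le; apply/and3P; split=> //; apply: Hd.
- exact: GB.
- exact: GB.
- exact: HG.
- exact: FB.
- exact: FB.
- exact: HF.
Qed.

Definition good_fold (n : nat) (e : R * R -> R * R -> R) (f : R -> R)
    (G : R * R -> R * R) :=
  [/\ continuous G,
      forall p q, `|p| <= 2 -> `|q| <= 2 -> G p = G q -> p = q,
      forall p, `|p| <= 2 -> `|G p| <= 2 /\ e (axis f p) (G p) <= 2^-1 ^+ n,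
      G 0 = 0 &
      forall p, `|p| <= 2 -> (G p).1 = 0 -> (G p).2 <= 0 ->
        p.1 = 0 /\ p.2 <= 0].

Lemma continuous_axis (f : R -> R) : continuous f -> continuous (axis f).
Proof.
move=> cf; apply: continuous_pair => p; last exact: cvg_cst.
by apply: continuous_comp; [exact: cvg_fst|exact: cf].
Qed.

Lemma axis_le1 (f : R -> R) (p : R * R) : (forall x, `|f x| <= 1) -> `|axis f p| <= 1.
Proof. by move=> fb; rewrite pair_norm_le /= fb normr0 ler01. Qed.

Variable f : nat -> R -> R.
Hypothesis cf : forall n, continuous (f n).
Hypothesis f_bound : forall n x, `|f n x| <= 1.
Hypothesis fold_f : forall n delta, 0 < delta -> exists G, fold_of (f n) delta G.

Lemma good_fold_exists (n : nat) (e : R * R -> R * R -> R) :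
  admissible e -> exists G, good_fold n e (f n) G.
Proof.
move=> [_ _ eC _ eU].
have [d d0 Hd] := eU (2^-1 ^+ n) ltac:(by rewrite exprn_gt0// invr_gt0).
(* The bound 1 keeps the box invariant, since [axis] has norm at most 1; the bound [d] controls the
   error in [e]. *)
have [|G [cG iG aG G0 rG]] := @fold_f n (Num.min d 1); first by rewrite lt_min d0 ltr01.
have aF p : `|axis (f n) p| <= 1 by apply: axis_le1.
have GB p : `|p| <= 2 -> `|G p| <= 2.
  move=> /aG; rewrite le_min => /andP[_ h].
  rewrite -[G p](subrK (axis (f n) p)) (le_trans (ler_normD _ _))//.
  by have := aF p; move: h; rewrite -/(axis (f n) p); lra.
exists G; split=> // p p2; split; first exact: GB.
apply: Hd; [by apply: (le_trans (aF p)); lra|exact: GB|].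
by rewrite distrC; move: (aG p p2); rewrite le_min => /andP[].
Qed.

(* Each fold is chosen after, and relative to, all the previous ones: [e n]
   dominates the distances of the images under every composite of the first
   [n] folds and bonding maps. *)
Lemma tower_exists : exists (G : nat -> R * R -> R * R) (e : nat -> R * R -> R * R -> R),
  forall n, [/\ admissible (e n), good_fold n (e n) (f n) (G n) &
    forall p q, e n (G n p) (G n q) <= e n.+1 p q /\
      e n (axis (f n) p) (axis (f n) q) <= e n.+1 p q].
Proof.
(* A fold is chosen for every index and metric at once, so the recursion below only has to produce
   metrics. *)
have ex (ne : nat * (R * R -> R * R -> R)) :
    exists G, admissible ne.2 -> good_fold ne.1 ne.2 (f ne.1) G.
  have [/(good_fold_exists ne.1)[G]|] := pselect (admissible ne.2); last by exists id.
  by exists G.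
have [S HS] := choice ex.
pose e := fix e n := if n is m.+1 then refine (e m) (axis (f m)) (S (m, e m))
  else fun p q => `|p - q|.
have adm n : admissible (e n).
  elim: n => [|n IH]; first exact: admissible_dist.
  have [cG _ GB _ _] := HS (n, e n) IH.
  apply: admissible_refine => // [|p _|p p2]; first exact: continuous_axis.
    by apply: (le_trans (axis_le1 _ _)); [exact: f_bound|lra].
  by case: (GB p p2).
exists (fun n => S (n, e n)), e => n; split; [exact: adm|exact: HS (n, e n) (adm n)|].
by move=> p q; rewrite /= /refine !le_max !lexx !orbT.
Qed.

End Tower.

(** * Geometrically convergent sequences *)

Section GeometricLimit.
Context {R : realType}.

(** The intervals of centre [u k] and radius [2 * c * 2^-1 ^+ k] are nested, and the supremum of
    their left ends lies in all of them. *)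
Lemma geometric_limit_real (u : nat -> R) (c : R) :
  (forall k, `|u k - u k.+1| <= c * 2^-1 ^+ k) ->
  exists l, forall k, `|l - u k| <= 2 * c * 2^-1 ^+ k.
Proof.
move=> Hu; pose r k := 2 * c * 2^-1 ^+ k.
have rS k : r k.+1 = c * 2^-1 ^+ k by rewrite /r exprS; field.
have rE k : r k = 2 * r k.+1 by rewrite rS /r; ring.
have step k : u k - r k <= u k.+1 - r k.+1 /\ u k.+1 + r k.+1 <= u k + r k.
  by have := rE k; have := Hu k; rewrite -rS ler_norml => /andP[? ?] ?; split; lra.
have mono j : forall k, u k - r k <= u (k + j)%N - r (k + j)%N /\
    u (k + j)%N + r (k + j)%N <= u k + r k.
  elim: j => [|j IH] k; first by rewrite addn0.
  have [? ?] := IH k; have [? ?] := step (k + j)%N.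
  by rewrite addnS; split; lra.
have r0 k : 0 <= r k by rewrite rE rS; have := Hu k; have := normr_ge0 (u k - u k.+1); lra.
have below j k : u j - r j <= u k + r k.
  have [? _] := mono k j; have [_ H] := mono j k; rewrite addnC in H.
  by have := r0 (j + k)%N; lra.
pose A := range (fun j => u j - r j).
have supA : has_sup A.
  split; first by exists (u 0%N - r 0%N), 0%N.
  by exists (u 0%N + r 0%N) => _ [j _ <-]; exact: below.
exists (sup A) => k; rewrite ler_distl; apply/andP; split.
  by apply: ub_le_sup; [exact: supA.2|exists k].
by apply: ge_sup => [|_ [j _ <-]]; [exact: supA.1|exact: below].
Qed.

Lemma geometric_limit (u : nat -> R * R) (c : R) :
  (forall k, `|u k - u k.+1| <= c * 2^-1 ^+ k) ->
  exists l, forall k, `|l - u k| <= 2 * c * 2^-1 ^+ k.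
Proof.
move=> Hu.
have [|l1 H1] := @geometric_limit_real (fun k => (u k).1) c.
  by move=> k; have := Hu k; rewrite pair_norm_le => /andP[].
have [|l2 H2] := @geometric_limit_real (fun k => (u k).2) c.
  by move=> k; have := Hu k; rewrite pair_norm_le => /andP[].
by exists (l1, l2) => k; rewrite pair_norm_le /= H1 H2.
Qed.

Lemma le0_geometric (x c : R) : (forall k, x <= c * 2^-1 ^+ k) -> x <= 0.
Proof.
move=> H; rewrite leNgt; apply/negP => x0.
have c0 : 0 < c by have := H 0%N; rewrite expr0 mulr1; exact: lt_le_trans.
have [k Hk] : exists k : nat, c / x < k%:R.
  by exists (Num.truncn (c / x)).+1; exact: truncnS_gt.
have k2 : (k%:R : R) <= 2 ^+ k by rewrite -natrX ler_nat ltnW// ltn_expl.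
have := H k; rewrite exprVn leNgt => /negP; apply.
rewrite ltr_pdivrMr ?exprn_gt0// mulrC -ltr_pdivrMr//.
exact: lt_le_trans k2.
Qed.

Lemma small_geometric (c delta : R) : 0 < delta -> exists k, c * 2^-1 ^+ k <= delta.
Proof.
move=> delta0; apply: contrapT => H; suff : delta <= 0 by rewrite leNgt delta0.
apply: (@le0_geometric _ c) => k; rewrite leNgt; apply/negP => /ltW h.
by apply: H; exists k.
Qed.

End GeometricLimit.

(** * The planar image of the inverse limit *)

Section Limit.
Context {R : realType}.
Variables (f : nat -> R -> R) (G : nat -> R * R -> R * R).
Variable e : nat -> R * R -> R * R -> R.
Hypothesis f0 : forall n, f n 0 = 0.
Hypothesis tower : forall n, [/\ admissible (e n),
  good_fold n (e n) (f n) (G n) &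
  forall p q, e n (G n p) (G n q) <= e n.+1 p q /\
    e n (axis (f n) p) (axis (f n) q) <= e n.+1 p q].

Definition thread (x : nat -> R) :=
  (forall n, `|x n| <= 1) /\ forall n, f n (x n.+1) = x n.

(** This is [G_n ... G_(n+k-1) (x_(n+k), 0)], the [k]-th approximation to [p_n]. *)
Fixpoint chart k n (x : nat -> R) : R * R :=
  if k is k'.+1 then G n (chart k' n.+1 x) else (x n, 0).

Lemma chart_box x : thread x -> forall k n, `|chart k n x| <= 2.
Proof.
move=> [xB _]; elim=> [|k IH] n /=.
  by rewrite pair_norm_le /= normr0 ler0n andbT (le_trans (xB n))// ler1n.
by have [_ [_ _ GB _ _] _] := tower n; case: (GB _ (IH n.+1)).
Qed.

Lemma axis_thread x n : thread x -> axis (f n) (chart 0 n.+1 x) = chart 0 n x.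
Proof. by move=> [_ xE]; rewrite /axis /= xE. Qed.

(** The two charts differ by the error of the fold at level [n + k], which the 1-Lipschitz folds
    carry down to level [n]. *)
Lemma chart_step x : thread x -> forall k n,
  e n (chart k n x) (chart k.+1 n x) <= 2^-1 ^+ (n + k).
Proof.
move=> xT; elim=> [|k IH] n; have [_ [_ _ GB _ _] eS] := tower n.
  rewrite addn0 -(axis_thread n xT).
  by case: (GB _ (chart_box xT 0 n.+1)).
rewrite addnS -addSn; apply: le_trans (IH n.+1).
by case: (eS (chart k n.+1 x) (chart k.+1 n.+1 x)).
Qed.

(** The charts converge in norm, but the estimate is needed in [e n]; uniform smallness of [e n] on
    the box transfers the telescoped bounds to the limit. *)
Lemma limit_chart x : thread x -> exists p : nat -> R * R, forall n,
  [/\ `|p n| <= 2, p n = G n (p n.+1) &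
    forall k, e n (p n) (chart k n x) <= 2 * 2^-1 ^+ (n + k)].
Proof.
move=> xT.
have ex n : exists l, `|l| <= 2 /\
    forall k, e n l (chart k n x) <= 2 * 2^-1 ^+ (n + k).
  have [[e_ge _ eC eD eU] _ _] := tower n.
  have [|l Hl] := @geometric_limit R (fun k => chart k n x) (2^-1 ^+ n).
    by move=> k; rewrite -exprD (le_trans (e_ge _ _))// chart_step.
  have l2 : `|l| <= 2.
    rewrite -subr_le0; apply: (@le0_geometric _ _ (2 * 2^-1 ^+ n)) => k.
    have := ler_normD (l - chart k n x) (chart k n x); rewrite subrK.
    by have := Hl k; have := chart_box xT k n; lra.
  exists l; split=> // k.
  have far j : e n (chart k n x) (chart (k + j)%N n x) <=
      2 * 2^-1 ^+ (n + k) - 2 * 2^-1 ^+ (n + k + j).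
    elim: j => [|j IH]; first by rewrite !addn0 subrr; have [[_ -> _ _ _] _ _] := tower n.
    have := eD (chart k n x) (chart (k + j)%N n x) (chart (k + j).+1 n x).
    have := chart_step xT (k + j) n; rewrite !addnS addnA !exprS; lra.
  apply/ler_addgt0Pr => eps eps0; have [d d0 Hd] := eU _ eps0.
  have [j Hj] := small_geometric (2 * 2^-1 ^+ n * 2^-1 ^+ k) d0.
  have h1 : e n l (chart (k + j)%N n x) <= eps.
    apply: Hd => //; first exact: chart_box.
    by apply: (le_trans (Hl _)); rewrite exprD mulrA.
  have := eD l (chart (k + j)%N n x) (chart k n x); rewrite (eC (chart (k + j)%N n x)).
  have : 0 <= 2^-1 ^+ (n + k + j) :> R by rewrite exprn_ge0.
  by have := far j; lra.
have [p Hp] := choice ex; exists p => n; have [pB pE] := Hp n; split=> //.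
have [[e_ge _ eC eD _] _ eS] := tower n; have [_ pE'] := Hp n.+1.
(* Both sides are close to [chart k.+1 n x], for every [k]. *)
apply/eqP; rewrite -subr_eq0 -normr_le0; apply: (@le0_geometric _ _ 2) => k.
have := e_ge (p n) (G n (p n.+1)).
have := eD (p n) (chart k.+1 n x) (G n (p n.+1)); have := pE k.+1.
have [+ _] := eS (p n.+1) (chart k n.+1 x); have := pE' k; rewrite eC /=.
have : 2^-1 ^+ (n.+1 + k) <= 2^-1 * 2^-1 ^+ k :> R.
  rewrite -exprS; apply: ler_wiXn2l => //; last by rewrite addSn ltnS leq_addl.
  by lra.
by rewrite addnS -addSn; lra.
Qed.

(** Each [axis (f m)] is 1-Lipschitz from [e m.+1] to [e m], so every later level controls the
    coordinate [n]. *)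
Lemma thread_dist x y : thread x -> thread y -> forall j n,
  `|x n - y n| <= e (n + j)%N (chart 0 (n + j)%N x) (chart 0 (n + j)%N y).
Proof.
move=> xT yT j n; have [[e_ge _ _ _ _] _ _] := tower n.
have : `|x n - y n| <= e n (chart 0 n x) (chart 0 n y).
  by apply: le_trans (e_ge _ _); rewrite prod_normE /= le_max lexx.
elim: j => [|j IH]; first by rewrite addn0.
move=> /IH h; apply: (le_trans h); rewrite addnS.
have [_ _ eS] := tower (n + j)%N.
by rewrite -(axis_thread _ xT) -(axis_thread _ yT); case: (eS (chart 0 (n + j).+1 x) (chart 0 (n + j).+1 y)).
Qed.

Lemma thread0 : thread (fun=> 0).
Proof. by split=> [n|n]; rewrite ?normr0// f0. Qed.

(** The tolerance is twice the error of [chart 0 m], as is needed for two threads with common limit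
    points; [thread_dist] makes it arbitrarily small in each coordinate. *)
Lemma eq_thread x y : thread x -> thread y ->
  (forall m, e m (chart 0 m x) (chart 0 m y) <= 4 * 2^-1 ^+ m) -> x = y.
Proof.
move=> xT yT H; apply/funext => n; apply/eqP; rewrite -subr_eq0 -normr_le0.
apply: (@le0_geometric _ _ 4) => j; apply: (le_trans (thread_dist xT yT j n)).
apply: (le_trans (H _)); rewrite ler_pM2l//.
by apply: ler_wiXn2l; rewrite ?leq_addl//; lra.
Qed.

(** Equality of images lifts through the injective folds to all levels, and so does lying on the
    ray; [eq_thread] concludes in both cases. The last clause serves for the continuity of
    [Omega]. *)
Lemma planar_limit : exists Omega : (nat -> R) -> R * R,
  [/\ forall x y, thread x -> thread y -> Omega x = Omega y -> x = y,
      Omega (fun=> 0) = 0,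
      forall x, thread x -> (Omega x).1 = 0 -> (Omega x).2 <= 0 -> x = fun=> 0 &
      forall k x, thread x -> `|Omega x - chart k 0 x| <= 2 * 2^-1 ^+ k].
Proof.
have ex x : exists p : nat -> R * R, thread x -> forall n,
  [/\ `|p n| <= 2, p n = G n (p n.+1) &
    forall k, e n (p n) (chart k n x) <= 2 * 2^-1 ^+ (n + k)].
  by have [/limit_chart[p Hp]|] := pselect (thread x); [exists p|exists (fun=> 0)].
have [p Hp] := choice ex; exists (fun x => p x 0%N).
have near x m : thread x -> e m (p x m) (chart 0 m x) <= 2 * 2^-1 ^+ m.
  by move=> xT; have [_ _ /(_ 0%N)] := Hp x xT m; rewrite addn0.
have approx k x : thread x -> `|p x 0%N - chart k 0 x| <= 2 * 2^-1 ^+ k.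
  move=> xT; have [[e_ge _ _ _ _] _ _] := tower 0%N.
  by have [_ _ /(_ k)] := Hp x xT 0%N; rewrite add0n; apply: le_trans.
split=> //.
- move=> x y xT yT eq0; apply: eq_thread => // m.
  have pm : p x m = p y m.
    elim: m => // m IH; have [_ [_ iG _ _ _] _] := tower m.
    have [_ Ex _] := Hp x xT m; have [_ Ey _] := Hp y yT m.
    have [Bx _ _] := Hp x xT m.+1; have [By _ _] := Hp y yT m.+1.
    by apply: iG => //; rewrite -Ex -Ey.
  have [[_ _ eC eD _] _ _] := tower m.
  have := eD (chart 0 m x) (p x m) (chart 0 m y); rewrite (eC _ (p x m)).
  by have := near x m xT; have := near y m yT; rewrite -pm; lra.
- have chart0 k n : chart k n (fun=> 0) = 0.
    elim: k n => [//|k IH] n /=; rewrite IH.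
    by have [_ [_ _ _ -> _] _] := tower n.
  apply/eqP; rewrite -normr_le0; apply: (@le0_geometric _ _ 2) => k.
  by have := approx k _ thread0; rewrite chart0 subr0.
- move=> x xT x1 x2; symmetry; apply: eq_thread => //; first exact: thread0.
  have ray m : (p x m).1 = 0 /\ (p x m).2 <= 0.
    elim: m => // m [p1 p2]; have [_ [_ _ _ _ rG] _] := tower m.
    have [_ Ex _] := Hp x xT m; have [Bx _ _] := Hp x xT m.+1.
    by apply: rG => //; rewrite -Ex.
  move=> m; have [_ _ eS] := tower m.
  rewrite -(axis_thread _ xT).
  (* A point of the ray has first coordinate 0, so [axis (f m)] sends it to the origin. *)
  have -> : chart 0 m (fun=> 0) = axis (f m) (p x m.+1).
    by rewrite /axis (ray m.+1).1 f0.
  have [_ h] := eS (p x m.+1) (chart 0 m.+1 x); apply: (le_trans h).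
  apply: (le_trans (near x m.+1 xT)); rewrite exprS.
  by have : 0 <= 2^-1 ^+ m :> R by [rewrite exprn_ge0]; lra.
Qed.

End Limit.

(** * Embeddings of compact sets *)

(** The part of [A] outside [U] has compact, hence closed, image; by injectivity the complement of
    that image cuts out the image of [U]. *)
Lemma compact_embedding (S T : topologicalType) (A : set S) (g : S -> T) :
  hausdorff_space T -> compact A -> {within A, continuous g} -> set_inj A g ->
  embedding_on A g.
Proof.
move=> hT cA cg ig; split=> // U oU.
have cAU : compact (A `&` ~` U) by apply: compact_closedI => //; exact: open_closedC.
have ccl : closed (g @` (A `&` ~` U)).
  apply: compact_closed => //; apply: continuous_compact => //.
  by apply: continuous_subspaceW cg; exact: subIsetl.
exists (~` (g @` (A `&` ~` U))); first exact: closed_openC.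
apply/seteqP; split => [_ [x [Ax Ux] <-]|_ [[x Ax <-] nU]].
  split; first by exists x.
  by move=> [y [Ay nUy] /(ig _ _ (mem_set Ay) (mem_set Ax)) yx]; rewrite yx in nUy.
by exists x => //; split=> //; apply: contrapT => nUx; apply: nU; exists x.
Qed.

(** * Extending the bonding maps to the line *)

Section Extension.
Context {R : realType}.

Lemma ramp1_id (x : R) : `|x| <= 1 -> ramp 1 x = x.
Proof.
rewrite ler_norml => /andP[x1 x2].
have [[_ + _]|[h ->]|[h ->]] := rampP x (@ltr01 R); last 2 first.
- by apply/eqP; rewrite eq_le h x2.
- by apply/eqP; rewrite eq_le h x1.
by rewrite mul1r.
Qed.

Lemma ramp1_right (x : R) : 1 <= x -> ramp 1 x = 1.
Proof.
move=> x1; have [[h _ _]|[_ ->]//|[h _]] := rampP x (@ltr01 R); last by lra.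
by move: h; rewrite ltr_norml => /andP[_]; rewrite ltNge x1.
Qed.

Lemma ramp1_left (x : R) : x <= -1 -> ramp 1 x = -1.
Proof.
move=> x1; have [[h _ _]|[h _]|[_ ->]//] := rampP x (@ltr01 R); last by lra.
by move: h; rewrite ltr_norml ltNge x1.
Qed.

Lemma continuous_extension (f : R -> R) :
  {within `[-1, 1]%classic, continuous f} -> continuous (f \o ramp 1).
Proof.
move=> /subspace_continuousP cf x.
have Ax y : `[-1, 1]%classic (ramp 1 y : R).
  by rewrite /= in_itv /= -ler_norml ramp_le1.
apply: (@cvg_comp _ _ _ (ramp 1) f _ (within `[-1, 1]%classic (nbhs (ramp 1 x))));
  last exact: cf.
move=> U /= AU; have := continuous_ramp AU; rewrite /= nbhs_simpl /=.
by apply: filterS => y; apply; exact: Ax.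
Qed.

Lemma image_extension (f : R -> R) (x1 x2 : R) : -1 <= x1 -> x2 <= 1 ->
  (f \o ramp 1) @` `]x1, x2[%classic = f @` `]x1, x2[%classic.
Proof.
move=> x1l x2r; apply: eq_imagel => x /=; rewrite in_itv /= => /andP[? ?].
by rewrite ramp1_id// ler_norml; apply/andP; split; lra.
Qed.

Lemma extension_departures (f : R -> R) :
  ~ ((exists x1 x2, positive_radial_departure f x1 x2) /\
     (exists x1 x2, negative_radial_departure f x1 x2)) ->
  ~ ((exists x1 x2, positive_radial_departure (f \o ramp 1) x1 x2) /\
     (exists x1 x2, negative_radial_departure (f \o ramp 1) x1 x2)).
Proof.
have ends x1 x2 : -1 <= x1 < 0 -> 0 < x2 <= 1 ->
    (f \o ramp 1) x1 = f x1 /\ (f \o ramp 1) x2 = f x2.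
  move=> h1 h2 /=; rewrite !ramp1_id// ler_norml; apply/andP; split; lra.
move=> nboth [[a [b [h1 h2 H]]] [a' [b' [h1' h2' H']]]]; apply: nboth.
split; [exists a, b|exists a', b']; split=> //.
  have [<- <-] := ends _ _ h1 h2; rewrite -H image_extension//.
    by case/andP: h1.
  by case/andP: h2.
have [<- <-] := ends _ _ h1' h2'; rewrite -H' image_extension//.
  by case/andP: h1'.
by case/andP: h2'.
Qed.

End Extension.

(** * Compactness of the inverse limit *)

Section InverseLimit.
Context {R : realType} (f : nat -> R -> R).
Hypothesis f_map : forall n, interval_map (f n).

Let ext n := f n \o ramp 1.

Lemma inverse_limitE : inverse_limit f = [set x : {ptws nat -> R} | thread ext x].
Proof.
apply/seteqP; split => x [xB xE]; split=> n.
- by have := xB n; rewrite /= in_itv /= -ler_norml.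
- rewrite /ext /= ramp1_id ?xE//.
  by have := xB n.+1; rewrite /= in_itv /= -ler_norml.
- by rewrite /= in_itv /= -ler_norml xB.
- by rewrite -[RHS]xE /ext /= ramp1_id.
Qed.

Lemma proj_ptws (n : nat) : continuous (fun x : {ptws nat -> R} => x n).
Proof. exact: (@proj_continuous nat (fun=> R) n). Qed.

(** A closed subset of a Tychonoff cube: written with [ext], continuous on the whole line, the
    equations are closed conditions on the full product. *)
Lemma compact_inverse_limit : compact (inverse_limit f).
Proof.
have -> : inverse_limit f = [set x : {ptws nat -> R} | forall n, `[-1, 1]%classic (x n)] `&`
    \bigcap_n [set x : {ptws nat -> R} | ext n (x n.+1) - x n = 0].
  rewrite inverse_limitE; apply/seteqP; split => x /=.
    move=> [xB xE]; split => [n|n _ /=]; last by rewrite xE subrr.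
    by rewrite /= in_itv /= -ler_norml xB.
  move=> [xB xE]; split=> n; first by have := xB n; rewrite /= in_itv /= -ler_norml.
  by apply/eqP; rewrite -subr_eq0; apply/eqP; exact: (xE n I).
apply: compact_closedI.
  apply: (@tychonoff nat (fun=> R) (fun=> `[-1, 1]%classic)) => _.
  exact: segment_compact.
apply: closed_bigI => n _.
pose v (x : {ptws nat -> R}) : R := ext n (x n.+1).
have cv : continuous v.
  move=> x; apply: (@continuous_comp _ _ _ (fun x : {ptws nat -> R} => x n.+1) (ext n)).
    exact: proj_ptws.
  by apply: continuous_extension; case: (f_map n).
have cd : continuous (fun x : {ptws nat -> R} => v x - x n).
  by move=> x; exact: (cvgB (cv x) (@proj_ptws n x)).
exact: (preimage_closed (fun x _ => cd x) (@closed_eq R 0)).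
Qed.

Lemma continuous_chart (G : nat -> R * R -> R * R) :
  (forall n, continuous (G n)) ->
  forall k n, continuous (fun x : {ptws nat -> R} => chart G k n x).
Proof.
move=> cG; elim=> [|k IH] n.
  have c0 : continuous (fun _ : {ptws nat -> R} => 0 : R).
    exact: (@cst_continuous {ptws nat -> R} R 0).
  exact: (continuous_pair (@proj_ptws n) c0).
by move=> x; exact: (continuous_comp (IH n.+1 x) (cG n _)).
Qed.

End InverseLimit.

(** * The arc below the origin and the conclusion *)

Lemma is_arc_lower_segment (R : realType) :
  is_arc R [set q : R * R | q.1 = 0 /\ -1 <= q.2 <= 0].
Proof.
have cg : continuous (fun t : R => (0 : R, - t)).
  apply: continuous_pair => t; first exact: cvg_cst.
  exact: opp_continuous.
exists (fun t => (0, - t)).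
  apply: compact_embedding.
  - exact: norm_hausdorff.
  - exact: segment_compact.
  - exact: continuous_subspaceT.
  - by move=> s t _ _ [] /oppr_inj.
apply/seteqP; split => [[a b] [/= -> ab]|_ [t + <-]].
  by exists (- b); rewrite /= ?opprK// in_itv /=; lra.
by rewrite /= in_itv /= => ?; split=> //; lra.
Qed.

Theorem proposition5p2 (R : realType) (f : nat -> R -> R)
  (f_map : forall n, interval_map (f n))
  (f0 : forall n, f n 0 = 0)
  (f_nonconst_left : forall n, nonconstant_on `[-1, 0]%classic (f n))
  (f_nonconst_right : forall n, nonconstant_on `[0, 1]%classic (f n))
  (same_orientation : forall n,
     ~ ((exists x1 x2, positive_radial_departure (f n) x1 x2) /\
        (exists x1 x2, negative_radial_departure (f n) x1 x2))) :
  exists Omega : {ptws nat -> R} -> R * R,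
    embedding_on (inverse_limit f) Omega /\
    accessible (inverse_limit f) Omega (fun _ => 0).
Proof.
pose ext n := f n \o ramp 1.
have c_ext n : continuous (ext n).
  by apply: continuous_extension; case: (f_map n).
have ext0 n : ext n 0 = 0 by rewrite /ext /= ramp1_id ?normr0.
have ext_bound n x : `|ext n x| <= 1.
  rewrite ler_norml; have [_ fB] := f_map n.
  have := fB (ramp 1 x); rewrite /= !in_itv /=; apply.
  by rewrite -ler_norml ramp_le1.
have fold_ext n delta : 0 < delta -> exists G, fold_of (ext n) delta G.
  apply: fold_exists => //.
  - by move=> x x1; rewrite /ext /= !ramp1_left.
  - by move=> x x1; rewrite /ext /= !ramp1_right.
  - exact: extension_departures.
have [G [e tower]] := tower_exists c_ext ext_bound fold_ext.
have [emb [iO O0 rayO approxO]] := planar_limit ext0 tower.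
have XE := inverse_limitE f; rewrite -/ext in XE.
have X0 : inverse_limit f (fun=> 0) by rewrite XE; exact: thread0.
have cG n : continuous (G n) by have [_ [? _ _ _ _] _] := tower n.
exists emb; split.
  apply: compact_embedding.
  - exact: norm_hausdorff.
  - exact: compact_inverse_limit.
  - apply/subspace_continuousP => x Xx; apply/cvgrPdist_le => eps eps0.
    have eps3 : 0 < eps / 3 by rewrite divr_gt0.
    (* On the inverse limit [emb] is a uniform limit of the continuous charts. *)
    have [k Hk] := small_geometric 2 eps3.
    have near_x : nbhs (x : {ptws nat -> R})
        (fun y => `|chart G k 0 x - chart G k 0 y| <= eps / 3).
      by have /cvgrPdist_le/(_ _ eps3) := @continuous_chart R G cG k 0 x.
    change (nbhs (x : {ptws nat -> R})
      (fun y => inverse_limit f y -> `|emb x - emb y| <= eps)).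
    move: near_x; apply: filterS => y h3 Xy.
    have xT : thread ext x by move: Xx; rewrite XE.
    have yT : thread ext y by move: Xy; rewrite XE.
    have h1 := le_trans (approxO k x xT) Hk.
    have h2 := le_trans (approxO k y yT) Hk.
    have -> : emb x - emb y = (emb x - chart G k 0 x) +
        (chart G k 0 x - chart G k 0 y) + (chart G k 0 y - emb y).
      by rewrite !addrA !subrK.
    rewrite (le_trans (ler_normD _ _))//.
    have := ler_normD (emb x - chart G k 0 x) (chart G k 0 x - chart G k 0 y).
    rewrite (distrC (chart G k 0 y)); lra.
  - by move=> x y /set_mem + /set_mem; rewrite XE; exact: iO.
(* The arc is a segment of the ray, with upper end the image of the zero sequence; [rayO] excludes
   all other common points. *)
exists [set q : R * R | q.1 = 0 /\ -1 <= q.2 <= 0]; first exact: is_arc_lower_segment.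
apply/seteqP; split => [q [[q1 /andP[_ q2]] [x Xx Ox]]|_ ->] /=.
  rewrite -Ox; congr emb; apply: rayO; rewrite ?Ox //.
  by move: Xx; rewrite XE.
split; last by exists (fun=> 0).
by rewrite O0 /=; split=> //; lra.
Qed.
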